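(* Let $n=1$, and for $R_0,R_1>0$ and $t\in[0,1]$ let $R_t=(1-t)R_0+tR_1$ and $B_R=(-R,R)$. (i) The function $t\mapsto\log T_\gamma(B_{R_t})$ on $[0,1]$ is neither convex for all pairs $R_0,R_1>0$ nor concave for all pairs $R_0,R_1>0$; and for every $\alpha\in\mathbb{R}\setminus\{0\}$ there exist $R_0\neq R_1$ for which $t\mapsto T_\gamma(B_{R_t})^{\alpha}$ is not concave on $[0,1]$. (ii) Let $0<\delta\le\frac1{10}$. For every $\alpha>0$, the function $t\mapsto T_\gamma\bigl((1-t)\Omega_0+t\Omega_1\bigr)^{\alpha}$ is not convex on $[0,1]$, and neither is $t\mapsto\log T_\gamma\bigl((1-t)\Omega_0+t\Omega_1\bigr)$, in each of the following two cases: when $\Omega_0=(-\delta,\delta)$ and $\Omega_1=(-2-\delta,-2+\delta)\cup(2-\delta,2+\delta)$; and when $\Omega_0=(2-\delta,2+\delta)$ and $\Omega_1=-\Omega_0$.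
   Context: $\gamma$ is the standard Gaussian measure on $\mathbb{R}$, $d\gamma=(2\pi)^{-1/2}e^{-x^2/2}\,dx$. For a bounded open set $\Omega\subset\mathbb{R}$, the torsion function $u_\Omega$ is the solution of $u''-xu'=-1$ in $\Omega$, $u=0$ on $\partial\Omega$, and $T_\gamma(\Omega)=\int_\Omega u_\Omega\,d\gamma$ is the Gaussian torsional rigidity. The Minkowski combination is $(1-t)\Omega_0+t\Omega_1=\{(1-t)x_0+tx_1:\ x_0\in\Omega_0,\ x_1\in\Omega_1\}$. *)

(* Defs.v *)
From HB Require Import structures.
From mathcomp Require Import all_boot all_order all_algebra.
From mathcomp Require Import all_classical all_reals all_analysis.

Set Implicit Arguments.
Unset Strict Implicit.
Unset Printing Implicit Defensive.

Import Order.TTheory GRing.Theory Num.Theory.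
Import numFieldNormedType.Exports.

Local Open Scope classical_set_scope.
Local Open Scope ring_scope.

(* Classical solution of [u'' - x u' = -1] in [Omega], [u = 0] on the boundary.
   [Omega] is meant to be open, so its boundary is [closure Omega `\` Omega].
   Nothing is required of the values of [u] outside [closure Omega]. *)
Definition is_torsion_function (R : realType) (Omega : set R) (u : R -> R) :=
  [/\ {within closure Omega, continuous u},
      forall x, Omega x ->
        [/\ derivable u x 1, derivable u^`()%classic x 1
          & u^`(2)%classic x - x * u^`()%classic x = -1]
    & forall x, (closure Omega `\` Omega) x -> u x = 0].

(* For a bounded open [Omega] the solution exists and is unique on
   [closure Omega]; [get] returns one of its extensions to [R]. *)
Definition torsion_function (R : realType) (Omega : set R) : R -> R :=
  get (is_torsion_function Omega).

Definition torsional_rigidity (R : realType) (Omega : set R) : R :=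
  \int[normal_prob (0 : R) 1]_(x in Omega) torsion_function Omega x.

Definition minkowski_comb (R : realType) (t : R) (A B : set R) : set R :=
  [set (1 - t) * x + t * y | x in A & y in B].

Definition centered_ball (R : realType) (r : R) : set R := `]- r, r[.

Definition convex_on01 (R : realType) (f : R -> R) : Prop :=
  convex_function (E := R^o) `[0, 1] f.

Definition concave_on01 (R : realType) (f : R -> R) : Prop :=
  convex_on01 (fun t => - f t).

(* Main.v *)
Require Import Defs.
From HB Require Import structures.
From mathcomp Require Import all_boot all_order all_algebra.
From mathcomp Require Import all_classical all_reals all_analysis.
From mathcomp Require Import measurable_realfun ring lra.

Set Implicit Arguments.
Unset Strict Implicit.
Unset Printing Implicit Defensive.

Import Order.TTheory GRing.Theory Num.Theory.
Import numFieldNormedType.Exports.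

Local Open Scope classical_set_scope.
Local Open Scope ring_scope.

(** Write L u = u'' - x u' for the Ornstein-Uhlenbeck operator, so that the
torsion function solves L u = -1. No closed form of the torsional rigidity T
is used: every estimate compares u with an explicit sub- or supersolution.

The comparison principle (OU_max_principle) holds because L w >= 0 says that
w' exp(-x^2/2) is nondecreasing: if w were positive somewhere inside and
nonpositive at both ends, the mean value theorem would make w' positive at
some point and negative at a later one. The solution itself exists by two
integrations (OU_dirichlet), which gives the chosen torsion function its
defining properties.

Part (i). Comparing u on B_r with parabolas gives T(B_r) <= r^2 for small r,
and that r -> T(B_r) is positive and strictly increasing; comparing with
exp(r^2/4) - exp(x^2/4), a subsolution, gives T(B_s) >= c exp(s^2/4) for
s >= 2. Hence log T(B_r) tends to minus infinity at 0, which no convex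
function on (0, +oo) does; log T(B_s) grows faster than any affine function,
which no concave function does; for alpha > 0 the power T^alpha grows faster
than linearly as well; and for alpha < 0 the power is positive and strictly
decreasing, which no concave function on a half-line is. Each time the failure
is read off on one segment, [r, 2] at the point 1 or [1, s] at the point 2.

Part (ii). A convex function of t in [0, 1] is at most the larger of its two
end values, and so is a function whose logarithm or positive power is convex.
It thus suffices to find a t at which T exceeds both ends. An interval of
half-width delta around 2 or -2 carries much less rigidity than the one around
0, since the Gaussian weight drops by a factor of about exp(-2)
(far_torsion_le). When the ball is combined with the pair of far intervals,
t = delta/4 yields the larger ball of radius 3 delta/2
(minkowski_split); when the two far intervals are combined, t = 1/2 yields
the ball of radius delta (minkowski_midpoint_opp). In both cases the
combination sits at the centre and beats the two ends. *)

(** * The Ornstein-Uhlenbeck equation and its comparison principle *)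

Lemma closure_itvoo (R : realType) (a b : R) :
  a < b -> closure `]a, b[%classic = `[a, b]%classic.
Proof.
move=> ab; apply/seteqP; split; first exact: itv_closure.
move=> x /=; rewrite in_itv/= => /andP[ax xb] U /nbhs_ballP[e /= e0 eU].
pose d := Num.min (e / 2) ((b - a) / 4).
have d0 : 0 < d by rewrite lt_min; apply/andP; split; lra.
have de : d <= e / 2 by rewrite ge_min lexx.
have dab : d <= (b - a) / 4 by rewrite ge_min lexx orbT.
have [xm|xm] := leP x ((a + b) / 2).
  exists (x + d); split; first by rewrite /= in_itv/=; apply/andP; split; lra.
  by apply: eU; rewrite /ball/= opprD addNKr normrN gtr0_norm//; lra.
exists (x - d); split; first by rewrite /= in_itv/=; apply/andP; split; lra.
by apply: eU; rewrite /ball/= opprB addrC subrK gtr0_norm//; lra.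
Qed.

(** u'' - x u' = f on the open interval, with the first derivative u1 as an
explicit witness: differences of solutions are then handled with is_derive
alone, and only continuity is asked at the end points. *)
Definition OU_solution (R : realType) (a b : R) (u f : R -> R) :=
  {within `[a, b], continuous u} /\
  exists u1 : R -> R, {in `]a, b[, forall x : R,
    is_derive x 1 u (u1 x) /\ is_derive x 1 u1 (x * u1 x + f x)}.

Lemma within_segmentS (R : realType) (u : R -> R) (a b c d : R) :
  a <= c -> d <= b -> {within `[a, b], continuous u} ->
  {within `[c, d], continuous u}.
Proof.
move=> ac db; apply: continuous_subspaceW.
by apply: subset_itv; rewrite bnd_simp.
Qed.

Lemma is_derive_gauss (R : realType) (c x : R) :
  is_derive x 1 (fun y : R => expR (c * y ^+ 2)) (2 * c * x * expR (c * x ^+ 2)).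
Proof.
pose g := fun y : R => c * y ^+ 2.
have dg : is_derive x 1 g (2 * c * x).
  apply: is_derive_eq; rewrite /GRing.scale/=; ring.
have := @is_derive1_comp R expR g x _ _ (is_derive_expR (g x)) dg.
by rewrite mulrC.
Qed.

(** The equation says (w' exp(-x^2/2))' = f exp(-x^2/2) >= 0, so w' can only
change sign from negative to positive, whereas a positive interior value above
nonpositive end values forces the opposite change. *)
Lemma OU_max_principle (R : realType) (a b : R) (w f : R -> R) :
  OU_solution a b w f -> {in `]a, b[, forall x, 0 <= f x} ->
  w a <= 0 -> w b <= 0 -> {in `]a, b[, forall x, w x <= 0}.
Proof.
move=> [wc [w1 dw]] f0 wa wb c cab; rewrite leNgt; apply/negP => wc0.
move: (cab); rewrite in_itv/= => /andP[ac cb].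
have [p pac wp] : exists2 p, p \in `]a, c[ & w c - w a = w1 p * (c - a).
  apply: MVT => //; last by apply: within_segmentS wc; rewrite // ltW.
  move=> x xac; apply: (dw x _).1.
  by move: xac; rewrite !in_itv/= => /andP[-> /lt_trans->].
have [q qcb wq] : exists2 q, q \in `]c, b[ & w b - w c = w1 q * (b - c).
  apply: MVT => //; last by apply: within_segmentS wc; rewrite // ltW.
  move=> x xac; apply: (dw x _).1.
  by move: xac; rewrite !in_itv/= => /andP[/(lt_trans ac)-> ->].
move: pac qcb; rewrite !in_itv/= => /andP[ap pc] /andP[cq qb].
have w1p : 0 < w1 p.
  have ca : 0 < c - a by lra.
  by rewrite -(pmulr_lgt0 _ ca) -wp; lra.
have w1q : w1 q < 0.
  have bc : 0 < b - c by lra.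
  by rewrite -(pmulr_llt0 _ bc) -wq; lra.
(* The integrating factor: E' = - y E. *)
pose E := fun y : R => expR (- (1 / 2) * y ^+ 2).
have dE (x : R) : is_derive x 1 E (- x * E x).
  by apply: (is_derive_eq (is_derive_gauss _ _)); rewrite /E; field.
have dg x : x \in `]a, b[ -> is_derive x 1 (fun y => w1 y * E y) (f x * E x).
  move=> xab; have [_ d1] := dw x xab; have := dE x => d2.
  by apply: (is_derive_eq (is_deriveM d1 d2)); rewrite /GRing.scale/=; ring.
have sub x : x \in `[p, q] -> x \in `]a, b[.
  rewrite !in_itv/= => /andP[px xq].
  by rewrite (lt_le_trans ap px) (le_lt_trans xq qb).
have sub' x : x \in `]p, q[ -> x \in `]a, b[.
  by move=> xpq; apply: sub; apply: subset_itv_oo_cc xpq.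
have : w1 p * E p <= w1 q * E q.
  apply: (@ger0_derive1_ndecr R (fun y => w1 y * E y) p q) => //; last lra.
  - by move=> x /sub'/dg[].
  - move=> x /sub' xab; rewrite derive1E (@derive_val _ _ _ _ _ _ _ (dg x xab)).
    by rewrite mulr_ge0 ?f0// expR_ge0.
  - by apply: derivable_within_continuous => x /sub/dg[].
have : 0 < w1 p * E p by rewrite mulr_gt0// expR_gt0.
have : w1 q * E q < 0 by rewrite pmulr_llt0// expR_gt0.
lra.
Qed.

Lemma OU_explicit (R : realType) (a b : R) (u u1 f : R -> R) :
  (forall x : R, is_derive x 1 u (u1 x)) ->
  (forall x : R, is_derive x 1 u1 (x * u1 x + f x)) -> OU_solution a b u f.
Proof.
move=> du du1; split; last by exists u1.
by apply: derivable_within_continuous => x _; case: (du x).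
Qed.

Lemma OU_sub (R : realType) (a b : R) (u v f g : R -> R) :
  OU_solution a b u f -> OU_solution a b v g ->
  OU_solution a b (fun x => u x - v x) (fun x => f x - g x).
Proof.
move=> [uc [u1 du]] [vc [v1 dv]]; split.
  by move=> x; apply: continuousB; [exact: uc|exact: vc].
exists (fun x => u1 x - v1 x) => x xab.
have [du0 du1] := du x xab; have [dv0 dv1] := dv x xab.
split; first exact: is_deriveB.
by apply: (is_derive_eq (is_deriveB du1 dv1)); ring.
Qed.

Lemma OU_solutionS (R : realType) (a b c d : R) (u f : R -> R) :
  a <= c -> d <= b -> OU_solution a b u f -> OU_solution c d u f.
Proof.
move=> ac db [uc [u1 du]]; split; first exact: within_segmentS uc.
exists u1 => x; rewrite in_itv/= => /andP[cx xd]; apply: du.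
by rewrite in_itv/= (le_lt_trans ac cx) (lt_le_trans xd db).
Qed.

Lemma OU_comparison (R : realType) (a b : R) (u v f g : R -> R) :
  OU_solution a b u f -> OU_solution a b v g ->
  {in `]a, b[, forall x, g x <= f x} -> u a <= v a -> u b <= v b ->
  {in `]a, b[, forall x, u x <= v x}.
Proof.
move=> uf vg gf uva uvb x xab; rewrite -subr_le0.
by apply: (OU_max_principle (OU_sub uf vg)) x xab => [x xab||];
  rewrite ?subr_ge0 ?subr_le0// gf.
Qed.

(** * Existence of torsion functions *)

Definition dirichlet_torsion (R : realType) (a b : R) (u : R -> R) :=
  [/\ OU_solution a b u (fun=> -1), u a = 0 & u b = 0].

Lemma exists_antiderivative (R : realType) (f : R -> R) (a b : R) :
  {within `[a, b], continuous f} ->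
  exists F : R -> R, {in `]a, b[, forall x : R, is_derive x 1 F (f x)}.
Proof.
move=> cf; eexists => x xab; have := xab; rewrite in_itv/= => /andP[ax xb].
have fx : {for x, continuous f}.
  by have := within_continuous_continuous (lt_trans ax xb) cf xab.
have fi : lebesgue_measure.-integrable `[a, b] (EFin \o f).
  exact/continuous_compact_integrable/cf/segment_compact.
have [dF F'] := @continuous_FTC1 R f (BLeft a) x b xb fi ax fx.
by rewrite -F' derive1E; exact/derivableP/dF.
Qed.

(** With the integrating factor, u' = e^{x^2/2} (B - P), where P is a primitive
of e^{-x^2/2}; integrating once more, B is fixed by u b = 0. *)
Lemma OU_dirichlet (R : realType) (a b : R) : a < b ->
  exists u : R -> R, dirichlet_torsion a b u.
Proof.
move=> ab.
pose e1 := fun x : R => expR (1 / 2 * x ^+ 2).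
pose e2 := fun x : R => expR (- (1 / 2) * x ^+ 2).
have de1 (x : R) : is_derive x 1 e1 (x * e1 x).
  by apply: (is_derive_eq (is_derive_gauss _ _)); rewrite /e1; field.
have de2 (x : R) : is_derive x 1 e2 (- x * e2 x).
  by apply: (is_derive_eq (is_derive_gauss _ _)); rewrite /e2; field.
have ce (e : R -> R) e' (c d : R) : (forall x : R, is_derive x 1 e (e' x)) ->
    {within `[c, d], continuous e}.
  by move=> de; apply: derivable_within_continuous => x _; case: (de x).
(* P lives on a larger interval than H and G, because e1 * P has to be
   continuous on the closed interval on which it is integrated. *)
have [P dP] := exists_antiderivative (ce e2 _ (a - 2) (b + 2) de2).
have [H dH] := exists_antiderivative (ce e1 _ (a - 1) (b + 1) de1).
have cPe : {within `[a - 1, b + 1], continuous (fun x => e1 x * P x)}.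
  apply: derivable_within_continuous => x; rewrite in_itv/= => /andP[ax xb].
  have dPx : is_derive x 1 P (e2 x) by apply: dP; rewrite in_itv/=; lra.
  have := de1 x => de1x.
  by case: (is_deriveM de1x dPx).
have [G dG] := exists_antiderivative cPe.
have sub (x : R) : x \in `[a, b] -> (x \in `]a - 1, b + 1[) /\ (x \in `]a - 2, b + 2[).
  by rewrite !in_itv/=; lra.
have Hab : H a < H b.
  apply: (@gtr0_derive1_incr R H a b) => //.
  - by move=> x /subset_itv_oo_cc/sub[/dH[]].
  - move=> x /subset_itv_oo_cc/sub[/dH dHx _].
    by rewrite derive1E (@derive_val _ _ _ _ _ _ _ dHx) expR_gt0.
  - by apply: derivable_within_continuous => x /sub[/dH[]].
pose B := (G b - G a) / (H b - H a).
pose u := fun x => B * (H x - H a) - (G x - G a).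
have du (x : R) : x \in `[a, b] -> is_derive x 1 u (B * e1 x - e1 x * P x).
  move=> /sub[xab _]; have dHx := dH x xab; have dGx := dG x xab.
  by apply: is_derive_eq; rewrite /GRing.scale/=; ring.
exists u; split.
- split; first by apply: derivable_within_continuous => x /du[].
  exists (fun x => B * e1 x - e1 x * P x) => x /subset_itv_oo_cc xab.
  split; first exact: du.
  have [_ xab2] := sub x xab; have dPx := dP x xab2; have := de1 x => de1x.
  apply: is_derive_eq; rewrite /GRing.scale/=.
  have : e1 x * e2 x = 1.
    by rewrite -expRD -mulrDl addrN mul0r expR0.
  lra.
- by rewrite /u !subrr mulr0 subr0.
- by rewrite /u /B divfK ?subrr// gt_eqF// subr_gt0.
Qed.

(** The end points of a component of Omega lie on the boundary of Omega, so the
torsion problem decouples over the components. *)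
Lemma torsion_OU (R : realType) (Omega : set R) (u : R -> R) (a b : R) :
  a < b -> `]a, b[%classic `<=` Omega -> ~ Omega a -> ~ Omega b ->
  is_torsion_function Omega u ->
  dirichlet_torsion a b u.
Proof.
move=> ab abO aO bO [uc du u0].
have abcl : `[a, b]%classic `<=` closure Omega.
  by rewrite -closure_itvoo//; exact: closure_subset.
split.
- split; first exact: continuous_subspaceW abcl uc.
  exists (u^`()%classic) => x xab.
  have [d1 d2 e] := du x (abO x xab); split.
    by rewrite derive1E; exact: derivableP.
  have -> : x * u^`()%classic x + -1 = u^`(2)%classic x by lra.
  by rewrite derive1nS derive1E derive1n1; exact: derivableP.
- by apply: u0; split=> //; apply: abcl; rewrite /= in_itv/= lexx ltW.
- by apply: u0; split=> //; apply: abcl; rewrite /= in_itv/= lexx ltW.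
Qed.

(** Being a solution at an interior point is a local property; this is what
allows gluing. *)
Lemma OU_near (R : realType) (a b : R) (u v f : R -> R) (x : R) :
  OU_solution a b u f -> x \in `]a, b[ -> {near x, u =1 v} ->
  [/\ derivable v x 1, derivable v^`()%classic x 1
    & v^`(2)%classic x - x * v^`()%classic x = f x].
Proof.
move=> [_ [u1 du]] xab uv.
have v1 : \forall y \near x, is_derive (y : R) 1 v (u1 y).
  have := near_in_itvoo xab; move: uv => /near_join uv xn; near=> y.
  apply: (@near_eq_is_derive _ _ _ u); first by near: y.
  by have /du[] : y \in `]a, b[ by near: y.
have vE : \forall y \near x, u1 y = v^`()%classic y.
  by apply: filterS v1 => y dv; rewrite derive1E derive_val.
have dv := nbhs_singleton v1.
have dv1 := near_eq_is_derive vE (du x xab).2.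
split; [by case: dv|by case: dv1|].
by rewrite derive1nS derive1E derive1n1 (@derive_val _ _ _ _ _ _ _ dv1)
  -(nbhs_singleton vE); ring.
Unshelve. all: by end_near. Qed.

Lemma exists_torsion_itv (R : realType) (a b : R) : a < b ->
  exists u, is_torsion_function `]a, b[%classic u.
Proof.
move=> ab; have [u [uOU ua ub]] := OU_dirichlet ab; exists u.
rewrite /is_torsion_function closure_itvoo//; split.
- by case: uOU.
- by move=> x /= xab; apply: (OU_near uOU xab); apply: filterE.
- move=> x [/=]; rewrite !in_itv/= => /andP[ax xb] /negP.
  by rewrite negb_and -!leNgt => /orP[xa|bx];
    [rewrite (_ : x = a)|rewrite (_ : x = b)] => //; lra.
Qed.

(** The solutions on the two intervals are glued at a point m of the gap
between them, away from which they are locally unchanged. *)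
Lemma exists_torsion_itvU (R : realType) (a b c d : R) : a < b -> b < c -> c < d ->
  exists u, is_torsion_function (`]a, b[ `|` `]c, d[)%classic u.
Proof.
move=> ab bc cd.
have [u [uOU ua ub]] := OU_dirichlet ab; have [v [vOU vc vd]] := OU_dirichlet cd.
pose m := (b + c) / 2.
pose w := fun x : R => if x < m then u x else v x.
have uw x : x < m -> {near x, u =1 w}.
  by move=> xm; apply: filterS (lt_nbhsl xm) => y ym; rewrite /w ym.
have vw x : m < x -> {near x, v =1 w}.
  move=> xm; apply: filterS (lt_nbhsr xm) => y ym; rewrite /w ifF//.
  by apply/negbTE; rewrite -leNgt ltW.
exists w; rewrite /is_torsion_function closureU !closure_itvoo//; split.
- apply: withinU_continuous; rewrite -?closure_itvoo//; try exact: closed_closure.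
    rewrite closure_itvoo//; case: uOU => uc _.
    apply: (@subspace_eq_continuous _ _ _ u) => // x.
    rewrite inE/= in_itv/= => /andP[_ xb]; rewrite /from_subspace /w/= ifT// /m; lra.
  rewrite closure_itvoo//; case: vOU => vc0 _.
  apply: (@subspace_eq_continuous _ _ _ v) => // x.
  rewrite inE/= in_itv/= => /andP[cx _]; rewrite /from_subspace /w/= ifF// /m; lra.
- move=> x [] /= xi; have := xi; rewrite in_itv/= => /andP[x1 x2].
    by apply: (OU_near uOU xi); apply: uw; rewrite /m; lra.
  by apply: (OU_near vOU xi); apply: vw; rewrite /m; lra.
- move=> x [/= xcl /not_orP[/negP xab /negP xcd]]; move: xcl xab xcd.
  rewrite /w /m !in_itv/= => -[] /andP[x1 x2] xab xcd.
    rewrite ifT; last lra.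
    move: xab; rewrite negb_and -!leNgt => /orP[xa|bx];
    [rewrite (_ : x = a)|rewrite (_ : x = b)] => //; lra.
  rewrite ifF; last lra.
  by move: xcd; rewrite negb_and -!leNgt => /orP[xa|bx];
    [rewrite (_ : x = c)|rewrite (_ : x = d)] => //; lra.
Qed.

(** * Gaussian mass and integrals on intervals *)

Definition gauss_mass (R : realType) (a b : R) : R :=
  fine (normal_prob (0 : R) 1 `]a, b[%classic).

Definition gauss_int (R : realType) (a b : R) (u : R -> R) : R :=
  \int[normal_prob (0 : R) 1]_(x in `]a, b[%classic) u x.

Lemma gauss_pdfE (R : realType) (x : R) :
  normal_pdf 0 1 x = normal_peak 1 * expR (- (1 / 2) * x ^+ 2).
Proof.
by rewrite normal_pdfE ?oner_eq0// /normal_fun; congr (_ * expR _); field.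
Qed.

Lemma gauss_probE (R : realType) (a b : R) : normal_prob (0 : R) 1 `]a, b[%classic
  = (gauss_mass a b)%:E.
Proof. by rewrite /gauss_mass fineK// fin_num_measure. Qed.

Lemma gauss_mass_le (R : realType) (a b r : R) : a < b ->
  {in `]a, b[, forall x, r <= x ^+ 2} ->
  gauss_mass a b <= (b - a) * (normal_peak 1 * expR (- (1 / 2) * r)).
Proof.
move=> ab hr; rewrite -lee_fin -gauss_probE /normal_prob.
set M := normal_peak 1 * _.
have -> : ((b - a) * M)%:E = (\int[lebesgue_measure]_(x in `]a, b[) (cst M%:E) x)%E.
  by rewrite integral_cst//= lebesgue_measure_itv/= lte_fin ab -EFinD -EFinM mulrC.
apply: ge0_le_integral => //=.
- by move=> x _; rewrite lee_fin normal_pdf_ge0.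
- by apply/measurable_EFinP; apply: measurable_funTS; exact: measurable_normal_pdf.
- move=> x xab; rewrite lee_fin gauss_pdfE ler_wpM2l ?normal_peak_ge0// ler_expR.
  by have := hr x xab; lra.
Qed.

Lemma gauss_mass_ge (R : realType) (a b s : R) : a < b ->
  {in `]a, b[, forall x, x ^+ 2 <= s} ->
  (b - a) * (normal_peak 1 * expR (- (1 / 2) * s)) <= gauss_mass a b.
Proof.
move=> ab hs; rewrite -lee_fin -gauss_probE /normal_prob.
set M := normal_peak 1 * _.
have -> : ((b - a) * M)%:E = (\int[lebesgue_measure]_(x in `]a, b[) (cst M%:E) x)%E.
  by rewrite integral_cst//= lebesgue_measure_itv/= lte_fin ab -EFinD -EFinM mulrC.
apply: ge0_le_integral => //=.
- by move=> x _; rewrite lee_fin mulr_ge0 ?normal_peak_ge0 ?expR_ge0.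
- by apply/measurable_EFinP; apply: measurable_funTS; exact: measurable_normal_pdf.
- move=> x xab; rewrite lee_fin gauss_pdfE ler_wpM2l ?normal_peak_ge0// ler_expR.
  by have := hs x xab; lra.
Qed.

Lemma gauss_mass_le1 (R : realType) (a b : R) : gauss_mass a b <= 1.
Proof. by rewrite -lee_fin -gauss_probE; exact: probability_le1. Qed.

Lemma gauss_mass_gt0 (R : realType) (a b : R) : a < b -> 0 < gauss_mass a b.
Proof.
move=> ab; apply: lt_le_trans (gauss_mass_ge (s := a ^+ 2 + b ^+ 2) ab _).
  by rewrite mulr_gt0 ?subr_gt0// mulr_gt0 ?expR_gt0// normal_peak_gt0// oner_eq0.
by move=> x; rewrite in_itv/= => /andP[ax xb]; have [x0|x0] := leP 0 x; nra.
Qed.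

Lemma gauss_integrable (R : realType) (a b : R) (u : R -> R) :
  {within `[a, b], continuous u} ->
  (normal_prob (0 : R) 1).-integrable `]a, b[%classic (EFin \o u).
Proof.
move=> uc.
have iu : (normal_prob (0 : R) 1).-integrable `[a, b]%classic (EFin \o u).
  apply: measurable_bounded_integrable => //.
  - by rewrite (le_lt_trans (probability_le1 _ _)) ?ltry.
  - exact: subspace_continuous_measurable_fun.
  - have /compact_bounded[M [_ mrt]] := continuous_compact uc (@segment_compact _ a b).
    by exists M; split; rewrite ?num_real // => ? ? ? ?; exact: mrt.
by apply: integrableS iu => //; exact: subset_itv_oo_cc.
Qed.

Lemma gauss_int_le (R : realType) (a b k : R) (u : R -> R) :
  {within `[a, b], continuous u} -> {in `]a, b[, forall x, u x <= k} ->
  gauss_int a b u <= k * gauss_mass a b.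
Proof.
move=> uc uk; rewrite /gauss_int /gauss_mass -Rintegral_cst//.
apply: le_Rintegral => //; first exact: gauss_integrable.
by apply: gauss_integrable => x; exact: cst_continuous.
Qed.

Lemma gauss_int_subset (R : realType) (a b c d : R) (u : R -> R) :
  a <= c -> d <= b -> {within `[a, b], continuous u} ->
  {in `]a, b[, forall x, 0 <= u x} -> gauss_int c d u <= gauss_int a b u.
Proof.
move=> ac db uc u0.
have sub : `]c, d[%classic `<=` `]a, b[%classic.
  by apply: subset_itv; rewrite bnd_simp.
have iu := gauss_integrable uc.
rewrite /gauss_int /Rintegral fine_le//.
- by apply: integrable_fin_num => //; exact: integrableS iu.
- exact: integrable_fin_num.
- apply: ge0_subset_integral => //; first by case/integrableP: iu.
Qed.

Lemma gauss_int_shift_le (R : realType) (a b k : R) (u v : R -> R) :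
  {within `[a, b], continuous u} -> {within `[a, b], continuous v} ->
  {in `]a, b[, forall x, u x + k <= v x} ->
  gauss_int a b u + k * gauss_mass a b <= gauss_int a b v.
Proof.
move=> uc vc uv; rewrite /gauss_int /gauss_mass -Rintegral_cst//.
have ik : (normal_prob (0 : R) 1).-integrable `]a, b[%classic (EFin \o cst k).
  by apply: gauss_integrable => x; exact: cst_continuous.
rewrite -RintegralD//; last exact: gauss_integrable.
apply: le_Rintegral => //; last exact: gauss_integrable.
by apply: gauss_integrable => x; apply: continuousD; [exact: uc|exact: cst_continuous].
Qed.

(** A lower bound on a smaller interval suffices for a nonnegative integrand;
the subinterval avoids integrating parabolas against the Gaussian density. *)
Lemma gauss_int_ge (R : realType) (a b c d k : R) (u : R -> R) :
  a <= c -> d <= b -> {within `[a, b], continuous u} ->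
  {in `]a, b[, forall x, 0 <= u x} -> {in `]c, d[, forall x, k <= u x} ->
  k * gauss_mass c d <= gauss_int a b u.
Proof.
move=> ac db uc u0 uk; apply: le_trans (gauss_int_subset ac db uc u0).
have c0 : {within `[c, d], continuous (cst (0 : R))}.
  by move=> x; exact: cst_continuous.
have g0 : gauss_int c d (cst (0 : R)) = 0 by rewrite /gauss_int Rintegral_cst// mul0r.
rewrite -[leLHS]add0r -g0.
by apply: (gauss_int_shift_le c0 (within_segmentS ac db uc)) => x xcd;
  rewrite add0r uk.
Qed.

(** * Barriers for torsion functions *)

Lemma torsion_function_itv (R : realType) (a b : R) : a < b ->
  dirichlet_torsion a b (torsion_function `]a, b[%classic).
Proof.
move=> ab; apply: (@torsion_OU _ `]a, b[%classic) => //=.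
- by rewrite in_itv/= ltxx.
- by rewrite in_itv/= ltxx andbF.
- exact: getPex (exists_torsion_itv ab).
Qed.

Lemma OU_cst (R : realType) (a b k : R) : OU_solution a b (cst k) (fun=> 0).
Proof.
apply: (@OU_explicit _ _ _ _ (cst 0)) => x; apply: is_derive_eq => //.
by rewrite mulr0 addr0.
Qed.

(** The basic barrier: it vanishes at m - d and m + d, and L of it equals
- k (1 - (x - m) x), so it is a subsolution or a supersolution of the torsion
problem according to the position of k (1 - (x - m) x) with respect to 1. *)
Lemma OU_parabola (R : realType) (a b k m d : R) :
  OU_solution a b (fun x => k / 2 * (d ^+ 2 - (x - m) ^+ 2))
    (fun x => k * (x - m) * x - k).
Proof.
apply: (@OU_explicit _ _ _ _ (fun x => - k * (x - m))) => x;
  by apply: is_derive_eq; rewrite /GRing.scale/=; field.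
Qed.

Section dirichlet.
Context {R : realType}.
Implicit Types a b m d k : R.

Lemma dirichlet_torsion_ge0 a b (u : R -> R) : dirichlet_torsion a b u ->
  {in `]a, b[, forall x, 0 <= u x}.
Proof.
move=> [uOU ua ub] x xab.
by apply: (OU_comparison (OU_cst a b 0) uOU) => //; rewrite ?ua ?ub//= => y _; lra.
Qed.

Lemma parabola_le_torsion m d k (u : R -> R) :
  dirichlet_torsion (m - d) (m + d) u ->
  {in `]m - d, m + d[, forall x, k * (1 - (x - m) * x) <= 1} ->
  {in `]m - d, m + d[, forall x, k / 2 * (d ^+ 2 - (x - m) ^+ 2) <= u x}.
Proof.
move=> [uOU ua ub] kx.
apply: (OU_comparison (OU_parabola _ _ k m d) uOU) => [x /kx|/=|/=].
- lra.
- by rewrite ua; lra.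
- by rewrite ub; lra.
Qed.

Lemma torsion_le_parabola m d k (u : R -> R) :
  dirichlet_torsion (m - d) (m + d) u ->
  {in `]m - d, m + d[, forall x, 1 <= k * (1 - (x - m) * x)} ->
  {in `]m - d, m + d[, forall x, u x <= k / 2 * (d ^+ 2 - (x - m) ^+ 2)}.
Proof.
move=> [uOU ua ub] kx.
apply: (OU_comparison uOU (OU_parabola _ _ k m d)) => [x /kx|/=|/=].
- lra.
- by rewrite ua; lra.
- by rewrite ub; lra.
Qed.

Lemma gauss_int_torsion_gt0 a b (u : R -> R) : a < b -> dirichlet_torsion a b u ->
  0 < gauss_int a b u.
Proof.
move=> ab uD; pose m := (a + b) / 2; pose d := (b - a) / 2.
have aE : a = m - d by rewrite /m /d; field.
have bE : b = m + d by rewrite /m /d; field.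
have d0 : 0 < d by rewrite /d; lra.
(* 1 + m^2/4 is the maximum over x of 1 - (x - m) x. *)
pose k := (1 + m ^+ 2 / 4)^-1.
have k1 : 0 < 1 + m ^+ 2 / 4 by have := sqr_ge0 m; lra.
have k0 : 0 < k by rewrite invr_gt0.
have kE : k * (1 + m ^+ 2 / 4) = 1 by rewrite mulVf// gt_eqF.
have u0 := dirichlet_torsion_ge0 uD.
have [[uc _] _ _] := uD; rewrite aE bE in uD.
have uk : {in `]m - d / 2, m + d / 2[, forall x, k / 2 * (3 / 4 * d ^+ 2) <= u x}.
  move=> x; rewrite in_itv/= => /andP[x1 x2].
  apply: le_trans (parabola_le_torsion uD (k := k) _ _); last 2 first.
  - move=> y _; rewrite -[leRHS]kE ler_pM2l//.
    by have := sqr_ge0 (y - m / 2); lra.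
  - by rewrite in_itv/=; lra.
  by rewrite ler_pM2l; [nra|lra].
apply: lt_le_trans (gauss_int_ge _ _ uc u0 uk); [|rewrite aE; lra|rewrite bE; lra].
rewrite mulr_gt0 ?gauss_mass_gt0//; last lra.
by rewrite mulr_gt0 ?mulr_gt0 ?exprn_gt0//; lra.
Qed.

(** Near 2 or -2 the drift costs at most a factor 4/3 with respect to the
parabola, while the density drops by exp(-(2 - 2d)) <= exp(-9/5) <= 1/4 with
respect to its least value on ]-d, d[. The bound is written with that value,
so that it compares directly with the lower bound for centred balls. *)
Lemma far_torsion_le m d (u : R -> R) : m ^+ 2 = 4 -> 0 < d -> d <= 1 / 10 ->
  dirichlet_torsion (m - d) (m + d) u ->
  gauss_int (m - d) (m + d) u
    <= 1 / 3 * d ^+ 3 * (normal_peak 1 * expR (- (1 / 2) * d ^+ 2)).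
Proof.
move=> m4 d0 d1 uD; have [[uc _] _ _] := uD.
have m2 : m = 2 \/ m = - 2.
  have : (m - 2) * (m + 2) == 0 by apply/eqP; lra.
  by rewrite mulf_eq0 => /orP[] /eqP; [left|right]; lra.
have um : {in `]m - d, m + d[, forall x, u x <= 2 / 3 * d ^+ 2}.
  move=> x xI; apply: le_trans (torsion_le_parabola (k := 4 / 3) uD _ xI) _.
    move=> y; rewrite in_itv/= => /andP[y1 y2].
    (* y - m is at most 1/10 and y at most 21/10 in absolute value. *)
    have : (y - m) * y <= 21 / 100 by case: m2 => m2; subst m; nra.
    lra.
  by have := sqr_ge0 (x - m); lra.
apply: le_trans (gauss_int_le uc um) _.
have mass : gauss_mass (m - d) (m + d)
    <= 2 * d * (normal_peak 1 * (expR (- (1 / 2) * d ^+ 2) / 4)).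
  have mdd : m - d < m + d by lra.
  apply: le_trans (gauss_mass_le (r := (2 - d) ^+ 2) mdd _) _.
    by move=> y; rewrite in_itv/= => /andP[y1 y2]; case: m2 => m2; subst m; nra.
  have -> : m + d - (m - d) = 2 * d by ring.
  rewrite ler_pM2l ?mulr_gt0// ler_pM2l ?normal_peak_gt0 ?oner_eq0//.
  (* exp(9/5) = exp(3/5)^3 >= (8/5)^3 > 4 *)
  have e4 : 4 <= expR (9 / 5 : R).
    have -> : 9 / 5 = 3%:R * (3 / 5) :> R by field.
    rewrite expRM_natl; have : 8 / 5 <= expR (3 / 5 : R).
      by apply: le_trans (expR_ge1Dx _); lra.
    by move=> h; nra.
  rewrite ler_pdivlMr//.
  apply: le_trans (_ : expR (- (1 / 2) * (2 - d) ^+ 2) * expR (9 / 5) <= _).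
    by rewrite ler_pM2l ?expR_gt0.
  by rewrite -expRD ler_expR; nra.
apply: le_trans (ler_wpM2l _ mass) _; first by have := sqr_ge0 d; lra.
by rewrite le_eqVlt; apply/orP; left; apply/eqP; field.
Qed.

End dirichlet.

(** * Torsional rigidity of centred balls *)

(** A barrier of Gaussian growth: with y = x^2/4, L of it is (y - 1/2) e^y,
which stays above -1 because (1/2 - y) e^y <= (1 - y) e^y <= 1. *)
Lemma OU_exp_quarter (R : realType) (a b k : R) :
  OU_solution a b (fun x => k - expR (1 / 4 * x ^+ 2))
    (fun x => (x ^+ 2 / 4 - 1 / 2) * expR (1 / 4 * x ^+ 2)).
Proof.
pose e := fun x : R => expR (1 / 4 * x ^+ 2).
have de (x : R) : is_derive x 1 e (1 / 2 * x * e x).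
  by apply: (is_derive_eq (is_derive_gauss _ _)); rewrite /e; field.
apply: (@OU_explicit _ _ _ _ (fun x => - (1 / 2) * (x * e x))) => x; have := de x => dex.
  by apply: (is_derive_eq (is_deriveB (is_derive_cst k x 1) dex)); ring.
have dxe := is_deriveM (is_derive_id x 1) dex.
by apply: (is_derive_eq (is_deriveZ (- (1 / 2)) dxe)); rewrite /GRing.scale/= /e; field.
Qed.

Section balls.
Context {R : realType}.
Local Notation T := (@torsional_rigidity R).
Implicit Types r s : R.

Lemma torsion_itvE a b : T `]a, b[%classic
  = gauss_int a b (torsion_function `]a, b[%classic).
Proof. by []. Qed.

Lemma torsional_rigidity_itv_gt0 a b : a < b -> 0 < T `]a, b[%classic.
Proof. by move=> ab; exact/gauss_int_torsion_gt0/torsion_function_itv. Qed.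

Lemma torsional_rigidity_ball_gt0 r : 0 < r -> 0 < T (centered_ball r).
Proof. by move=> r0; apply: torsional_rigidity_itv_gt0; lra. Qed.

Lemma ball_parabola_le s (u : R -> R) : dirichlet_torsion (- s) s u ->
  {in `]- s, s[, forall x, 1 / 2 * (s ^+ 2 - x ^+ 2) <= u x}.
Proof.
move=> uD x xs; have -> : x ^+ 2 = (x - 0) ^+ 2 by rewrite subr0.
apply: (@parabola_le_torsion R 0 s 1 u); rewrite ?sub0r ?add0r// => y _.
by have := sqr_ge0 y; lra.
Qed.

(** Strictness comes from a positive constant: on ]-r, r[ both torsion functions
solve the same equation, and at r and -r the larger one is at least
(s^2 - r^2)/2. *)
Lemma torsional_rigidity_ball_lt r s : 0 < r -> r < s ->
  T (centered_ball r) < T (centered_ball s).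
Proof.
move=> r0 rs; rewrite !torsion_itvE.
set u := torsion_function _; set v := torsion_function _.
have uD : dirichlet_torsion (- r) r u by apply: torsion_function_itv; lra.
have vD : dirichlet_torsion (- s) s v by apply: torsion_function_itv; lra.
have v0 := dirichlet_torsion_ge0 vD.
have [uOU ur1 ur2] := uD; have [vOU vs1 vs2] := vD.
have [uc _] := uOU; have [vc _] := vOU.
apply: lt_le_trans (gauss_int_subset (c := - r) (d := r) _ _ vc v0); [|lra|lra].
have vOUr : OU_solution (- r) r v (fun=> -1) by apply: OU_solutionS vOU; lra.
pose k := (s ^+ 2 - r ^+ 2) / 2.
have k0 : 0 < k by rewrite /k; nra.
have vk x : x ^+ 2 = r ^+ 2 -> k <= v x.
  move=> xr; apply: le_trans (ball_parabola_le vD _); first by rewrite xr /k; lra.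
  by rewrite in_itv/=; nra.
have uv : {in `]- r, r[, forall x, u x + k <= v x}.
  move=> x xr; rewrite -lerBrDr.
  apply: (OU_comparison uOU (OU_sub vOUr (OU_cst (- r) r k))) => //=.
  - by move=> y _; lra.
  - by rewrite ur1 subr_ge0 vk// sqrrN.
  - by rewrite ur2 subr_ge0 vk.
have [vcr _] := vOUr; have := gauss_int_shift_le uc vcr uv.
have : 0 < k * gauss_mass (- r) r by rewrite mulr_gt0// gauss_mass_gt0//; lra.
by rewrite /gauss_int; lra.
Qed.

Lemma torsional_rigidity_ball_small r : 0 < r -> r <= 1 / 2 ->
  T (centered_ball r) <= r ^+ 2.
Proof.
move=> r0 r2; rewrite torsion_itvE.
set u := torsion_function _.
have uD : dirichlet_torsion (- r) r u by apply: torsion_function_itv; lra.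
have [[uc _] _ _] := uD.
have ur : {in `]- r, r[, forall x, u x <= r ^+ 2}.
  move=> x xr; have : u x <= 2 / 2 * (r ^+ 2 - (x - 0) ^+ 2).
    apply: (@torsion_le_parabola R 0 r 2 u); rewrite ?sub0r ?add0r// => y.
    by rewrite in_itv/= => /andP[y1 y2]; nra.
  by have := sqr_ge0 (x - 0); lra.
apply: le_trans (gauss_int_le uc ur) _.
by rewrite ler_piMr ?sqr_ge0// gauss_mass_le1.
Qed.

(** On ]-r, r[ the torsion function of the larger ball is at least
(s^2 - r^2)/2, and the Gaussian density is at least its value at r. *)
Lemma torsional_rigidity_ball_ge r s : 0 < r -> r < s ->
  (s ^+ 2 - r ^+ 2) * r * (normal_peak 1 * expR (- (1 / 2) * r ^+ 2))
    <= T (centered_ball s).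
Proof.
move=> r0 rs; rewrite torsion_itvE.
set v := torsion_function _.
have vD : dirichlet_torsion (- s) s v by apply: torsion_function_itv; lra.
have v0 := dirichlet_torsion_ge0 vD; have [[vc _] _ _] := vD.
have vr : {in `]- r, r[, forall x, 1 / 2 * (s ^+ 2 - r ^+ 2) <= v x}.
  move=> x; rewrite in_itv/= => /andP[x1 x2].
  apply: le_trans (ball_parabola_le vD _); first by nra.
  by rewrite in_itv/=; lra.
apply: le_trans (gauss_int_ge (c := - r) (d := r) _ _ vc v0 vr); [|lra|lra].
have rr : - r < r by lra.
have mr : {in `]- r, r[, forall x, x ^+ 2 <= r ^+ 2}.
  by move=> x; rewrite in_itv/= => /andP[x1 x2]; nra.
have := gauss_mass_ge rr mr; set p := normal_peak 1 * _ => h.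
have k0 : 0 <= 1 / 2 * (s ^+ 2 - r ^+ 2) by nra.
by have := ler_wpM2l k0 h; lra.
Qed.

(** The barrier exp(s^2/4) - exp(x^2/4) is integrated over ]-1, 1[ only, where
it is a fixed fraction of exp(s^2/4) once s >= 2. *)
Lemma torsional_rigidity_ball_growth : exists2 c : R, 0 < c &
  forall s, 2 <= s -> c * expR (s ^+ 2 / 4) <= T (centered_ball s).
Proof.
pose q := expR (- (3 / 4) : R).
have q1 : q < 1 by rewrite -expR0 ltr_expR; lra.
have mass0 : 0 < gauss_mass (- 1) (1 : R) by apply: gauss_mass_gt0; lra.
exists ((1 - q) * gauss_mass (- 1) 1); first by rewrite mulr_gt0// subr_gt0.
move=> s s2; rewrite torsion_itvE.
set v := torsion_function _.
have vD : dirichlet_torsion (- s) s v by apply: torsion_function_itv; lra.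
have v0 := dirichlet_torsion_ge0 vD; have [vOU vs1 vs2] := vD; have [vc _] := vOU.
have vexp : {in `]- s, s[, forall x, expR (1 / 4 * s ^+ 2) - expR (1 / 4 * x ^+ 2) <= v x}.
  apply: (OU_comparison (OU_exp_quarter (- s) s _) vOU) => [x _|/=|/=].
  - set y := x ^+ 2 / 4; have y0 : 0 <= y by rewrite divr_ge0 ?sqr_ge0.
    have -> : 1 / 4 * x ^+ 2 = y by rewrite /y; field.
    have [yh|yh] := leP (1 / 2) y.
      by have := expR_gt0 y; nra.
    have : expR y * expR (- y) = 1 by rewrite -expRD subrr expR0.
    have := expR_gt0 y; have := expR_ge1Dx (- y); nra.
  - by rewrite sqrrN vs1 subrr.
  - by rewrite vs2 subrr.
have v1 : {in `]- 1, 1[, forall x, (1 - q) * expR (s ^+ 2 / 4) <= v x}.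
  move=> x; rewrite in_itv/= => /andP[x1 x2].
  apply: le_trans (vexp x _); last by rewrite in_itv/=; lra.
  have -> : 1 / 4 * s ^+ 2 = s ^+ 2 / 4 by field.
  by rewrite mulrBl; apply: lerB; [rewrite mul1r|rewrite -expRD ler_expR; nra].
apply: le_trans (gauss_int_ge (c := - 1) (d := 1) _ _ vc v0 v1); [|lra|lra].
by rewrite le_eqVlt; apply/orP; left; apply/eqP; ring.
Qed.

End balls.

(** * Convexity and concavity on the unit interval *)

Section convexity.
Context {R : realType}.
Implicit Types (f g : R -> R) (t : R).

Lemma convex_on01_le f t : convex_on01 f -> 0 <= t -> t <= 1 ->
  f t <= (1 - t) * f 0 + t * f 1.
Proof.
move=> cf t0 t1.
(* The combination puts the weight t on its first point, hence on 1. *)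
have h : f (t * 1 + (1 - t) * 0) <= t * f 1 + (1 - t) * f 0.
  by apply: (cf (Itv01 t0 t1) 1 0); rewrite inE/= in_itv/= lexx ler01.
by move: h; rewrite mulr1 mulr0 addr0 addrC.
Qed.

Lemma concave_on01_ge f t : concave_on01 f -> 0 <= t -> t <= 1 ->
  (1 - t) * f 0 + t * f 1 <= f t.
Proof. by move=> /convex_on01_le cf t0 t1; have := cf t t0 t1; lra. Qed.

Lemma not_convex_on01_peak f t : 0 <= t -> t <= 1 -> f 0 < f t -> f 1 < f t ->
  ~ convex_on01 f.
Proof.
move=> t0 t1 f0 f1 /convex_on01_le/(_ t0 t1); rewrite leNgt => /negP; apply.
have [t12|t12] := leP t (1 / 2); nra.
Qed.

Lemma not_convex_powR_ln_peak f t alpha : 0 < alpha -> 0 <= t -> t <= 1 ->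
    0 < f 0 -> 0 < f 1 -> f 0 < f t -> f 1 < f t ->
  ~ convex_on01 (fun s => f s `^ alpha) /\ ~ convex_on01 (fun s => ln (f s)).
Proof.
move=> al t0 t1 f0 f1 f0t f1t; have ft := lt_trans f0 f0t.
split; apply: (not_convex_on01_peak t0 t1).
- by apply: gt0_ltr_powR; rewrite // nnegrE ltW.
- by apply: gt0_ltr_powR; rewrite // nnegrE ltW.
- by rewrite ltr_ln ?posrE.
- by rewrite ltr_ln ?posrE.
Qed.

Lemma quadratic_beats_affine (a b : R) : exists2 s : R, 3 <= s & a * s + b < s ^+ 2 / 4.
Proof.
exists (4 * (`|a| + `|b| + 1)); have := normr_ge0 a; have := normr_ge0 b; first lra.
have := ler_norm a; have := ler_norm b; nra.
Qed.
End convexity.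

Section log_and_power_not_concave.
Context {R : realType}.
Implicit Types (F g : R -> R).
Local Notation Rt R0 R1 t := ((1 - t) * R0 + t * R1 : R).

(** On [r, 2] convexity bounds ln (F 1) by a combination in which ln (F r) has
weight at least 1/2, while ln (F r) <= 2 ln r is arbitrarily negative. *)
Lemma log_not_convex_of_vanishing F : (forall r : R, 0 < r -> 0 < F r) ->
  (forall r : R, 0 < r -> r <= 1 / 2 -> F r <= r ^+ 2) ->
  ~ (forall R0 R1 : R, 0 < R0 -> 0 < R1 ->
       convex_on01 (fun t => ln (F (Rt R0 R1 t)))).
Proof.
move=> F0 Fsmall cv; pose m := `|ln (F 1)| + `|ln (F 2)| + 1.
have n1 := normr_ge0 (ln (F 1)); have n2 := normr_ge0 (ln (F 2)).
have m1 : 1 <= m by rewrite /m; lra.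
pose r := expR (- m); have r0 : 0 < r by exact: expR_gt0.
have r12 : r <= 1 / 2.
  have : r * expR m = 1 by rewrite -expRD addNr expR0.
  by have := expR_ge1Dx m; nra.
have lnF : ln (F r) <= - (2 * m).
  have -> : - (2 * m) = ln (r ^+ 2) by rewrite lnXn// expRK; ring.
  rewrite ler_ln ?posrE ?exprn_gt0//; last exact: F0.
  exact: Fsmall.
(* The parameter of the point 1 on the segment from r to 2. *)
pose t := (1 - r) / (2 - r).
have tE : t * (2 - r) = 1 - r by rewrite divfK//; lra.
have t0 : 0 <= t by rewrite divr_ge0; lra.
have t12 : t <= 1 / 2 by nra.
have t1 : t <= 1 by lra.
have := convex_on01_le (cv r 2 r0 (ltr0Sn _ 1)) t0 t1.
have -> : Rt r 2 t = 1 by lra.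
have -> : Rt r 2 0 = r by lra.
have -> : Rt r 2 1 = 2 by lra.
have bound_r : (1 - t) * ln (F r) <= - m.
  have u0 : 0 <= 1 - t by lra.
  by have := ler_wpM2l u0 lnF; nra.
have bound_2 : t * ln (F 2) <= `|ln (F 2)|.
  apply: le_trans (ler_wpM2l t0 (ler_norm _)) _.
  by rewrite ler_piMl.
by have := ler_norm (- ln (F 1)); rewrite normrN /m in bound_r *; lra.
Qed.

(** The form in which concavity is contradicted: the point 2 of [1, s] has
parameter 1/(s - 1), so g s is bounded by an affine function of s. *)
Lemma concave_at2 g (s : R) : 1 < s - 1 ->
  concave_on01 (fun t => g (Rt 1 s t)) ->
  (s - 2) * g 1 + g s <= (s - 1) * g 2.
Proof.
move=> s2 cv; pose t := (s - 1)^-1.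
have s10 : 0 < s - 1 by lra.
have tE : (s - 1) * t = 1 by rewrite divff// gt_eqF.
have t0 : 0 <= t by rewrite invr_ge0 ltW.
have t1 : t <= 1 by rewrite invf_le1; lra.
have := concave_on01_ge cv t0 t1.
have -> : Rt 1 s t = 2 by lra.
have -> : Rt 1 s 0 = 1 by lra.
have -> : Rt 1 s 1 = s by lra.
rewrite -(ler_pM2l s10) mulrDr !mulrA mulrBr mulr1 tE mul1r; lra.
Qed.

Lemma ln_gauss_growth F (c s : R) : 0 < c -> c * expR (s ^+ 2 / 4) <= F s ->
  ln c + s ^+ 2 / 4 <= ln (F s).
Proof.
move=> c0 Fs; have cs : 0 < c * expR (s ^+ 2 / 4) by rewrite mulr_gt0 ?expR_gt0.
rewrite -(expRK (s ^+ 2 / 4)) -lnM ?posrE ?expR_gt0//.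
by rewrite ler_ln// posrE// (lt_le_trans cs Fs).
Qed.

Lemma log_not_concave_of_growth F :
  (exists2 c : R, 0 < c & forall s : R, 2 <= s -> c * expR (s ^+ 2 / 4) <= F s) ->
  ~ (forall R0 R1 : R, 0 < R0 -> 0 < R1 ->
       concave_on01 (fun t => ln (F (Rt R0 R1 t)))).
Proof.
move=> [c c0 Fc] cv.
have [s s3 sq] := quadratic_beats_affine (ln (F 2) - ln (F 1))
  (2 * ln (F 1) - ln (F 2) - ln c).
have [s1 s0 s2] : [/\ 1 < s - 1, 0 < s & 2 <= s] by split; lra.
have := concave_at2 (g := fun r => ln (F r)) s1 (cv 1 s ltr01 s0).
by have := ln_gauss_growth c0 (Fc s s2); lra.
Qed.

(** Taking logarithms turns linear growth of F^alpha into an affine bound on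
ln F, against the quadratic growth of ln F. *)
Lemma pos_power_not_concave_of_growth F (alpha : R) : 0 < alpha ->
  0 < F 2 ->
  (exists2 c : R, 0 < c & forall s : R, 2 <= s -> c * expR (s ^+ 2 / 4) <= F s) ->
  exists2 s : R, 2 < s & ~ concave_on01 (fun t => F (Rt 1 s t) `^ alpha).
Proof.
move=> al F2 [c c0 Fc].
have [s s3 sq] := quadratic_beats_affine alpha^-1 (ln (F 2) - ln c).
have [s1 s2 s2'] : [/\ 1 < s - 1, 2 < s & 2 <= s] by split; lra.
exists s => // /(concave_at2 (g := fun r => F r `^ alpha) s1).
have Fs : 0 < F s by apply: lt_le_trans (Fc s s2'); rewrite mulr_gt0 ?expR_gt0.
have : alpha^-1 * s + ln (F 2) < ln (F s).
  by have := ln_gauss_growth c0 (Fc s s2'); lra.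
rewrite -(ltr_pM2l al) mulrDr mulrA divff ?gt_eqF// mul1r => lt.
have P1 : 0 <= F 1 `^ alpha by exact: powR_ge0.
have P2 : 0 < F 2 `^ alpha by exact: powR_gt0.
have : (s + 1) * F 2 `^ alpha <= F s `^ alpha.
  rewrite /powR !gt_eqF//.
  apply: (@le_trans _ _ (expR s * expR (alpha * ln (F 2)))).
    by rewrite ler_pM2r ?expR_gt0// addrC expR_ge1Dx.
  by rewrite -expRD ler_expR ltW.
nra.
Qed.

(** A positive concave function g cannot satisfy g 2 < g 1, since letting s grow
in concave_at2 gives g 1 <= g 2; the power g = F^alpha reverses F 1 < F 2. *)
Lemma neg_power_not_concave F (alpha : R) : alpha < 0 -> 0 < F 1 -> F 1 < F 2 ->
  exists2 s : R, 2 < s & ~ concave_on01 (fun t => F (Rt 1 s t) `^ alpha).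
Proof.
move=> al F1 F12; have F2 := lt_trans F1 F12.
pose p1 := F 1 `^ alpha; pose p2 := F 2 `^ alpha.
have p120 : 0 < p1 - p2.
  by rewrite subr_gt0 /p1 /p2 /powR !gt_eqF// ltr_expR ltr_nM2l// ltr_ln ?posrE.
have p20 : 0 < p2 by exact: powR_gt0.
pose s := 3 + p1 / (p1 - p2).
have sE : (s - 3) * (p1 - p2) = p1 by rewrite /s addrC addKr divfK ?gt_eqF.
have s3 : 3 < s by rewrite /s ltrDl divr_gt0//; lra.
have [s1 s2] : 1 < s - 1 /\ 2 < s by split; lra.
exists s => // /(concave_at2 (g := fun r => F r `^ alpha) s1); rewrite -/p1 -/p2.
have : 0 <= F s `^ alpha by exact: powR_ge0.
nra.
Qed.

End log_and_power_not_concave.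

(** * Minkowski combinations of far intervals *)

Section minkowski.
Context {R : realType}.
Implicit Types (A B : set R).

Lemma minkowski_comb0 A B : B !=set0 -> minkowski_comb 0 A B = A.
Proof.
move=> [b Bb]; apply/seteqP; split => x.
  by move=> [y Ay [z Bz <-]]; rewrite subr0 mul1r mul0r addr0.
by move=> Ax; exists x => //; exists b => //; rewrite subr0 mul1r mul0r addr0.
Qed.

Lemma minkowski_comb1 A B : A !=set0 -> minkowski_comb 1 A B = B.
Proof.
move=> [a Aa]; apply/seteqP; split => x.
  by move=> [y Ay [z Bz <-]]; rewrite subrr mul1r mul0r add0r.
by move=> Bx; exists a => //; exists x => //; rewrite subrr mul1r mul0r add0r.
Qed.

(** At time t the two translates are centred at -2t and 2t; for t = d/4 these
centres are at distance d/2 from 0, so the translates overlap. *)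
Lemma minkowski_split (d : R) : 0 < d -> d <= 1 / 10 ->
  minkowski_comb (d / 4) `]- d, d[%classic
    (`]-2 - d, -2 + d[ `|` `]2 - d, 2 + d[)%classic = centered_ball (3 / 2 * d).
Proof.
move=> d0 d1; apply/seteqP; split => x.
  move=> [y /= + [z + <-]]; rewrite /centered_ball /= !in_itv/= => /andP[y1 y2].
  by case=> /andP[z1 z2]; nra.
rewrite /centered_ball /= in_itv/= => /andP[x1 x2].
have [x0|x0] := leP 0 x.
  exists (x - d / 2); first by rewrite /= in_itv/=; lra.
  exists (2 + (x - d / 2)); last by field.
  by right; rewrite /= in_itv/=; lra.
exists (x + d / 2); first by rewrite /= in_itv/=; lra.
exists (- 2 + (x + d / 2)); last by field.
by left; rewrite /= in_itv/=; lra.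
Qed.

Lemma image_opp_itv (a b : R) :
  [set - x | x in `]a, b[%classic] = `]- b, - a[%classic.
Proof.
apply/seteqP; split => x.
  by move=> [y + <-]; rewrite /= !in_itv/=; lra.
by rewrite /= in_itv/= => xab; exists (- x); rewrite ?opprK//= in_itv/=; lra.
Qed.

Lemma minkowski_midpoint_opp (d : R) :
  minkowski_comb (1 / 2) `]2 - d, 2 + d[%classic
    [set - x | x in `]2 - d, 2 + d[%classic] = centered_ball d.
Proof.
apply/seteqP; split => x.
  move=> [y + [_ [z + <-] <-]]; rewrite /centered_ball /= !in_itv/=.
  by move=> /andP[y1 y2] /andP[z1 z2]; lra.
rewrite /centered_ball /= in_itv/= => /andP[x1 x2].
exists (2 + x); first by rewrite /= in_itv/=; lra.
exists (- (2 - x)); last by field.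
by exists (2 - x) => //; rewrite /= in_itv/=; lra.
Qed.
End minkowski.

Lemma integrable_setU d (X : measurableType d) (R : realType)
    (mu : {measure set X -> \bar R}) (A B : set X) (f : X -> \bar R) :
  measurable A -> measurable B -> [disjoint A & B] ->
  mu.-integrable A f -> mu.-integrable B f -> mu.-integrable (A `|` B) f.
Proof.
move=> mA mB AB /integrableP[mfA fA] /integrableP[mfB fB].
have mf : measurable_fun (A `|` B) f by apply/measurable_funU.
apply/integrableP; split => //.
by rewrite ge0_integral_setU//; [exact: lte_add_pinfty|exact: measurableT_comp].
Qed.

Section two_intervals.
Context {R : realType}.
Local Notation T := (@torsional_rigidity R).

Lemma torsional_rigidity_far_union (d : R) : 0 < d -> d <= 1 / 10 ->
  0 < T (`]-2 - d, -2 + d[ `|` `]2 - d, 2 + d[)%classic <=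
  2 / 3 * d ^+ 3 * (normal_peak 1 * expR (- (1 / 2) * d ^+ 2)).
Proof.
move=> d0 d1.
have ab : -2 - d < -2 + d by lra.
have bc : -2 + d < 2 - d by lra.
have cd : 2 - d < 2 + d by lra.
pose Om := (`]-2 - d, -2 + d[ `|` `]2 - d, 2 + d[)%classic : set R.
have uT : is_torsion_function Om (torsion_function Om).
  exact: getPex (exists_torsion_itvU ab bc cd).
have uD1 : dirichlet_torsion (-2 - d) (-2 + d) (torsion_function Om).
  apply: torsion_OU uT => //; first exact: subsetUl.
  - by case; rewrite /= in_itv/=; lra.
  - by case; rewrite /= in_itv/=; lra.
have uD2 : dirichlet_torsion (2 - d) (2 + d) (torsion_function Om).
  apply: torsion_OU uT => //; first exact: subsetUr.
  - by case; rewrite /= in_itv/=; lra.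
  - by case; rewrite /= in_itv/=; lra.
have -> : T Om = gauss_int (-2 - d) (-2 + d) (torsion_function Om)
    + gauss_int (2 - d) (2 + d) (torsion_function Om).
  have dis : [disjoint `]-2 - d, -2 + d[%classic & `]2 - d, 2 + d[%classic].
    by apply/disj_setPS => x [/=]; rewrite !in_itv/=; lra.
  rewrite /torsional_rigidity Rintegral_setU//.
  have [[u1 _] _ _] := uD1; have [[u2 _] _ _] := uD2.
  by apply: integrable_setU => //; exact: gauss_integrable.
have g1 := gauss_int_torsion_gt0 ab uD1.
have g2 := gauss_int_torsion_gt0 cd uD2.
have e4 : (2 : R) ^+ 2 = 4 by ring.
have e4' : (- 2 : R) ^+ 2 = 4 by ring.
have := far_torsion_le e4 d0 d1 uD2; have := far_torsion_le e4' d0 d1 uD1.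
by set X := normal_peak 1 * _; lra.
Qed.

(** In units of d^3 times the Gaussian density at d, the two far intervals
together have at most 2/3; the parabola of the larger ball is at least
5 d^2/8 on ]-d, d[, which gives 5/4. *)
Lemma far_union_lt_ball (d : R) : 0 < d -> d <= 1 / 10 ->
  0 < T (`]-2 - d, -2 + d[ `|` `]2 - d, 2 + d[)%classic < T (centered_ball (3 / 2 * d)).
Proof.
move=> d0 d1.
set p := normal_peak 1 * expR (- (1 / 2) * d ^+ 2).
have dp0 : 0 < d ^+ 3 * p.
  by rewrite !mulr_gt0 ?expR_gt0 ?normal_peak_gt0 ?oner_eq0.
have dd : d < 3 / 2 * d by lra.
have le : 2 / 3 * d ^+ 3 * p < ((3 / 2 * d) ^+ 2 - d ^+ 2) * d * p by lra.
have /andP[-> far] := torsional_rigidity_far_union d0 d1.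
apply: le_lt_trans far (lt_le_trans le _).
exact: torsional_rigidity_ball_ge.
Qed.

(** In units of d^3 times the Gaussian density at d, one far interval has at
most 1/3; the parabola of the ball is at least 3 d^2/8 on ]-d/2, d/2[, where
the density exceeds its value at d, which gives 3/8. *)
Lemma far_itv_lt_ball (m d : R) : m ^+ 2 = 4 -> 0 < d -> d <= 1 / 10 ->
  0 < T `]m - d, m + d[%classic < T (centered_ball d).
Proof.
move=> m4 d0 d1; have mdd : m - d < m + d by lra.
have dh : 0 < d / 2 by lra.
have dd : d / 2 < d by lra.
have d30 : 0 < 3 / 8 * d ^+ 3 by rewrite mulr_gt0 ?exprn_gt0//; lra.
set p := normal_peak 1 * expR (- (1 / 2) * d ^+ 2).
have p0 : 0 < d ^+ 3 * p.
  by rewrite !mulr_gt0 ?expR_gt0 ?normal_peak_gt0 ?oner_eq0.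
have pp : p <= normal_peak 1 * expR (- (1 / 2) * (d / 2) ^+ 2).
  by rewrite ler_pM2l ?normal_peak_gt0 ?oner_eq0// ler_expR; nra.
have le : 1 / 3 * d ^+ 3 * p
    < (d ^+ 2 - (d / 2) ^+ 2) * (d / 2)
      * (normal_peak 1 * expR (- (1 / 2) * (d / 2) ^+ 2)).
  by move: pp; rewrite -(ler_pM2l d30); lra.
rewrite torsional_rigidity_itv_gt0//=.
apply: le_lt_trans (far_torsion_le m4 d0 d1 (torsion_function_itv mdd)) _.
exact: lt_le_trans le (torsional_rigidity_ball_ge dh dd).
Qed.

End two_intervals.

(** * The theorem *)

Theorem theorem1p2 (R : realType) :
  let T := @torsional_rigidity R in
  let Rt (R0 R1 t : R) : R := (1 - t) * R0 + t * R1 in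
  let logT_balls (R0 R1 t : R) := ln (T (centered_ball (Rt R0 R1 t))) in
  [/\ ~ (forall R0 R1 : R, 0 < R0 -> 0 < R1 -> convex_on01 (logT_balls R0 R1)),
      ~ (forall R0 R1 : R, 0 < R0 -> 0 < R1 -> concave_on01 (logT_balls R0 R1))
    & forall alpha : R, alpha != 0 ->
        exists R0 R1 : R, [/\ 0 < R0, 0 < R1, R0 != R1
          & ~ concave_on01 (fun t => T (centered_ball (Rt R0 R1 t)) `^ alpha)]]
  /\
  (forall delta : R, 0 < delta -> delta <= 1 / 10 ->
   forall alpha : R, 0 < alpha ->
   let not_convex (Omega0 Omega1 : set R) :=
     ~ convex_on01 (fun t => T (minkowski_comb t Omega0 Omega1) `^ alpha) /\
     ~ convex_on01 (fun t => ln (T (minkowski_comb t Omega0 Omega1))) in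
   not_convex `]- delta, delta[%classic
              (`]-2 - delta, -2 + delta[ `|` `]2 - delta, 2 + delta[)%classic /\
   not_convex `]2 - delta, 2 + delta[%classic
              [set - x | x in `]2 - delta, 2 + delta[%classic]).
Proof.
pose F (r : R) := torsional_rigidity (centered_ball r).
split; first split.
- apply: (@log_not_convex_of_vanishing R F).
    exact: torsional_rigidity_ball_gt0.
  exact: torsional_rigidity_ball_small.
- apply: (@log_not_concave_of_growth R F).
  exact: torsional_rigidity_ball_growth.
- move=> alpha; rewrite neq_lt => alpha0.
  have [s s2 ncv] : exists2 s : R, 2 < s & ~ concave_on01
      (fun t => torsional_rigidity (centered_ball ((1 - t) * 1 + t * s)) `^ alpha).
    case/orP: alpha0 => alpha0.
      apply: (@neg_power_not_concave R F) => //.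
        exact: torsional_rigidity_ball_gt0.
      by apply: torsional_rigidity_ball_lt; rewrite ?ltr1n.
    apply: (@pos_power_not_concave_of_growth R F) => //.
      exact: torsional_rigidity_ball_gt0.
    exact: torsional_rigidity_ball_growth.
  exists 1, s; split=> //; first lra.
  by rewrite lt_eqF//; lra.
move=> delta d0 d1 alpha al; cbv zeta.
have [t0 t1] : 0 <= delta / 4 /\ delta / 4 <= 1 by split; lra.
have [h0 h1] : 0 <= 1 / 2 :> R /\ 1 / 2 <= 1 :> R by split; lra.
have dd : delta < 3 / 2 * delta by lra.
have [e4 e4'] : (2 : R) ^+ 2 = 4 /\ (- 2 : R) ^+ 2 = 4 by split; ring.
have I0x : `]- delta, delta[%classic 0 by rewrite /= in_itv/=; lra.
have I2x : `]2 - delta, 2 + delta[%classic 2 by rewrite /= in_itv/=; lra.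
have I2'x : `]-2 - delta, -2 + delta[%classic (-2) by rewrite /= in_itv/=; lra.
have I2E : [set - x | x in `]2 - delta, 2 + delta[%classic]
    = `]-2 - delta, -2 + delta[%classic.
  by rewrite image_opp_itv opprD opprB [delta - 2]addrC.
have mid := minkowski_midpoint_opp delta; rewrite I2E in mid.
rewrite I2E; split.
- have /andP[f0 f1] := far_union_lt_ball d0 d1.
  apply: (not_convex_powR_ln_peak al t0 t1);
    rewrite ?minkowski_split//;
    rewrite ?minkowski_comb0 ?minkowski_comb1//;
    try solve [exists 2; right => //|exists 0 => //].
  + exact: torsional_rigidity_ball_gt0.
  + exact: torsional_rigidity_ball_lt.
have /andP[f0 f1] := far_itv_lt_ball e4 d0 d1.
have /andP[g0 g1] := far_itv_lt_ball e4' d0 d1.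
by apply: (not_convex_powR_ln_peak al h0 h1); rewrite ?mid;
  rewrite ?minkowski_comb0 ?minkowski_comb1//;
  solve [exists 2 => //|exists (- 2) => //].
Qed.
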